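(* Let $X$ be a finite dimensional normed space, $P$ a closed subset of a finite dimensional normed space $Y$, and $A \subset X$ closed. Suppose that $f$ is l.s.c. on $A$ and $\varphi$ is l.s.c. on $A \times P$. Then the parametric penalty function $F_{\lambda}$ is (globally) exact if and only if $F_{\lambda}$ is non-degenerate and exact at every globally optimal solution of the problem $(\mathcal{P})$.
   Context: Setting. $M, A \subset X$ are nonempty, $f \colon X \to \mathbb{R} \cup \{+\infty\}$ with $\operatorname{dom} f = \{x : |f(x)| < +\infty\} \ne \emptyset$. The problem $(\mathcal{P})$ is: minimize $f(x)$ subject to $x \in M$, $x \in A$. Put $\Omega = M \cap A$; it is assumed that $f$ attains a global minimum on $\Omega$, with finite value $f^* = \min_{x\in\Omega} f(x)$. $P$ carries the metric induced from $Y$, $p_0 \in P$ is fixed, and $\varphi \colon X \times P \to [0, +\infty]$ satisfies $\varphi(x, p) = 0$ iff $p = p_0$ and $x \in M$. The parametric penalty function is $F_{\lambda}(x, p) = f(x) + \lambda \varphi(x, p)$, $\lambda \ge 0$. Global exactness: $F_\lambda$ is (globally) exact if there exists $\lambda_0 \ge 0$ such that $F_{\lambda_0}$ attains a global minimum on $A \times P$, and $(x^*, p^* )$ is a global minimizer of $F_{\lambda_0}$ on $A\times P$ iff $p^* = p_0$ and $x^*$ is a globally optimal solution of $(\mathcal{P})$. Local exactness: $F_\lambda$ is exact at a locally optimal solution $x^* \in \operatorname{dom} f$ of $(\mathcal{P})$ if there exists $\lambda_0 \ge 0$ such that $(x^*, p_0)$ is a local minimizer of $F_{\lambda_0}$ on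 $A \times P$. Non-degeneracy: $F_\lambda$ is non-degenerate if there exist $\lambda_0 \ge 0$ and $R > 0$ such that for every $\lambda \ge \lambda_0$ the function $F_\lambda$ attains a global minimum on $A \times P$ and there exists a global minimizer $(x_\lambda, p_\lambda)$ of $F_\lambda$ on $A \times P$ with $\|x_\lambda\|_X \le R$ and $\|p_\lambda\|_Y \le R$. ''L.s.c. on a set'' means lower semicontinuous at every point of that set. *)

(* Defs.v *)
From HB Require Import structures.
From mathcomp Require Import all_boot all_order all_algebra.
From mathcomp Require Import all_classical all_reals all_analysis.

Set Implicit Arguments.
Unset Strict Implicit.
Unset Printing Implicit Defensive.

Import Order.TTheory GRing.Theory Num.Theory.
Import numFieldNormedType.Exports.

Local Open Scope classical_set_scope.
Local Open Scope ring_scope.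
Local Open Scope ereal_scope.

#[short(type="normedVectType")]
HB.structure Definition NormedVector (R : numFieldType) :=
  {V of NormedModule R V & Vector R V}.

Section Minimizers.
Context {R : realType}.

Definition edom (T : Type) (g : T -> \bar R) : set T := [set x | `|g x| < +oo].

Definition global_minimizer (T : Type) (g : T -> \bar R) (S : set T) (x : T) :=
  S x /\ forall y, S y -> g x <= g y.

Definition local_minimizer (T : topologicalType) (g : T -> \bar R) (S : set T)
    (x : T) :=
  S x /\ \forall y \near x, S y -> g x <= g y.

Definition attains_global_min (T : Type) (g : T -> \bar R) (S : set T) :=
  exists x, global_minimizer g S x.

(* Pointwise form of the library's [lower_semicontinuous]: the neighbourhoods
   are those of the whole space, not of the set on which l.s.c. is required. *)
Definition lsc_at (T : topologicalType) (g : T -> \bar R) (x : T) :=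
  forall a : R, a%:E < g x -> \forall y \near x, a%:E < g y.

Definition lsc_on (T : topologicalType) (S : set T) (g : T -> \bar R) :=
  forall x, S x -> lsc_at g x.

End Minimizers.

(* [P] is used as a type, via the coercion of a set to its subtype, which
   carries the topology induced from [Y]. *)
Section ParametricPenalty.
Context {R : realType} {X Y : normedModType R}.
Context (f : X -> \bar R) (M A : set X) (P : set Y) (p0 : P).
Context (phi : X * P -> \bar R).

Definition globally_optimal (x : X) := global_minimizer f (M `&` A) x.

(* When [lam = 0] and [phi z = +oo], the product is [0]. *)
Definition penalty (lam : R) (z : X * P) : \bar R := f z.1 + lam%:E * phi z.

Definition globally_exact :=
  exists lam0 : R, [/\ (0 <= lam0)%R,
    attains_global_min (penalty lam0) (A `*` [set: P]) &
    forall (x : X) (p : P),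
      global_minimizer (penalty lam0) (A `*` [set: P]) (x, p) <->
      p = p0 /\ globally_optimal x].

(* Meant for [x] in [edom f] that is a local solution of the problem, which
   every global solution is when the optimal value is finite. *)
Definition exact_at (x : X) :=
  exists lam0 : R, (0 <= lam0)%R /\
    local_minimizer (penalty lam0) (A `*` [set: P]) (x, p0).

Definition non_degenerate :=
  exists lam0 r : R, [/\ (0 <= lam0)%R, (0 < r)%R &
    forall lam : R, (lam0 <= lam)%R ->
      attains_global_min (penalty lam) (A `*` [set: P]) /\
      exists (x : X) (p : P),
        [/\ global_minimizer (penalty lam) (A `*` [set: P]) (x, p),
            (`|x| <= r)%R & (`|val p| <= r)%R]].

End ParametricPenalty.

(* Main.v *)
(* Exactness implies the right-hand side because raising lambda keeps (x, p0),
   with x a solution, a minimizer.  Conversely, bounded minimizers z_n of the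
   penalty functions with parameters lambda_n -> +oo have a cluster point by
   compactness; since their values stay below f*, lower semicontinuity forces
   phi to vanish there, so the cluster point is (y, p0) with y a solution.
   Local exactness at y, applied to some z_n close to (y, p0), shows that the
   minimum value for lambda_n is f*, and then every larger parameter is exact. *)
Require Import Defs.
From mathcomp Require Import all_boot all_order all_algebra.
From mathcomp Require Import all_classical all_reals all_analysis.

Import Order.TTheory GRing.Theory Num.Theory.
Import numFieldNormedType.Exports.
Import VectorInternalTheory.

Local Open Scope classical_set_scope.
Local Open Scope ring_scope.

(** * Compactness of bounded closed sets in finite dimension *)

Lemma r2v_continuous (R : realType) (V : normedVectType R) :
  continuous (r2v : 'rV[R]_(dim V) -> V).
Proof.
(* By linearity, continuity reduces to that of each coordinate times a fixed vector, whatever the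
   norm of [V]. *)
have -> : (r2v : 'rV[R]_(dim V) -> V) =
    (fun u => \sum_i u ord0 i *: r2v (delta_mx ord0 i)).
  apply/funext => u; rewrite [in LHS](row_sum_delta u) linear_sum.
  by apply: eq_bigr => i _; rewrite linearZ.
apply: continuous_big; first exact: add_continuous.
move=> i _ u; apply: (@cvgZr_tmp _ _ _ (nbhs u)).
exact: coord_continuous.
Qed.

(** In the coordinates given by [r2v] the ball is closed, and bounded because the norm of [V]
    dominates a positive multiple of the norm of rows; Heine-Borel for rows applies, and [r2v]
    carries compactness back. *)
Lemma compact_norm_le (R : realType) (V : normedVectType R) (r : R) :
  compact [set x : V | `|x| <= r].
Proof.
have nc : continuous (fun u : 'rV[R]_(dim V) => `|r2v u : V|).
  move=> u; apply: continuous_comp; first exact: r2v_continuous.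
  exact: norm_continuous.
(* [c] is the minimum over the unit sphere of ['rV_(dim V)] of the norm of [V]. *)
pose S := [set u : 'rV[R]_(dim V) | `|u| = 1].
have [c c0 cle] : exists2 c : R, 0 < c & forall u, c * `|u| <= `|r2v u : V|.
  (* An empty sphere means that every row is zero, so any positive constant does. *)
  have [S0|/set0P/negP/negPn/eqP S0] := pselect (S !=set0); last first.
    exists 1 => // u; have [->|u0] := eqVneq u 0.
      by rewrite normr0 mulr0.
    suff : S (`|u|^-1 *: u) by rewrite S0.
    by rewrite /S/= normrZ normfV normr_id mulVf// normr_eq0.
  have Sc : compact S.
    apply: bounded_closed_compact.
      by exists 1; split => // M M1 u /= ->; exact: ltW.
    by apply: (preimage_closed _ (@closed_eq R 1)) => u _; exact: norm_continuous.
  have [u uS umin] := EVT_min_rV S0 Sc (continuous_subspaceT nc).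
  rewrite inE /S/= in uS.
  exists `|r2v u : V|.
    rewrite normr_gt0; apply/eqP => u0.
    have : u = 0 by apply: (@r2v_inj _ V); rewrite u0 linear0.
    by move=> u00; move: uS; rewrite u00 normr0 => /esym/eqP; rewrite oner_eq0.
  move=> v; have [->|v0] := eqVneq v 0.
    by rewrite normr0 mulr0.
  have nv : 0 < `|v| by rewrite normr_gt0.
  have := umin (`|v|^-1 *: v); rewrite inE /S/= normrZ normfV normr_id.
  rewrite mulVf ?gt_eqF// => /(_ erefl).
  by rewrite linearZ/= normrZ normfV normr_id ler_pdivlMl// mulrC.
have Kc : compact [set u : 'rV[R]_(dim V) | `|r2v u : V| <= r].
  apply: bounded_closed_compact.
    exists (r / c); split; first exact: num_real.
    move=> M Mr u /= ur; apply: le_trans (ltW Mr).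
    by rewrite ler_pdivlMr// mulrC (le_trans (cle u)).
  apply: (preimage_closed _ (@closed_le R r)) => u _; exact: nc.
have := continuous_compact (continuous_subspaceT (@r2v_continuous R V)) Kc.
congr compact; apply/seteqP; split => [_ [u ur <-]//|x xr].
by exists (v2r x); rewrite /= ?v2rK.
Qed.

(** A cluster point in [K] of the image filter is already a point of the subtype, whose open sets
    are traces of open sets of [T]. *)
Lemma compact_set_val_preimage (T : topologicalType) (A K : set T) :
  compact K -> K `<=` A -> compact (set_val @^-1` K : set A).
Proof.
move=> Kc KA F FF FK.
have [y [Ky Fy]] := Kc (set_val @ F) _ FK.
exists (SigSub (mem_set (KA _ Ky))); split => // B C FB [_ [[U oU <-]] Uy UC].
have UU : nbhs y U by apply: open_nbhs_nbhs.
have [|_ [[b Bb <-] Ub]] := Fy (set_val @` B) U _ UU.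
  by apply: (@filterS _ F _ B) FB => b Bb; exists b.
by exists b; split => //; exact: UC.
Qed.

(** Every tail of [z] meets each neighbourhood of [c]; this replaces the extraction of a convergent
    subsequence. *)
Lemma cluster_frequently {T : topologicalType} {z : nat -> T} {c : T}
    (Q : set T) (N : set nat) : cluster (z @ \oo) c ->
  nbhs c Q -> (\forall n \near \oo, N n) -> exists n, N n /\ Q (z n).
Proof.
move=> zc cQ [m _ mN].
have [|_ [[n mn <-] Qn]] := zc [set z n | n in [set n | (m <= n)%N]] Q _ cQ.
  by exists m => // n mn; exists n.
by exists n; split => //; exact: mN.
Qed.

Local Open Scope ereal_scope.

(** * Dependence of the penalty function on its parameter *)

Section Penalty.
Set Implicit Arguments.
Unset Strict Implicit.
Context {R : realType} {X Y : normedModType R}.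
Context {M A : set X} {P : set Y} {p0 : P}.
Context {f : X -> \bar R} {phi : X * P -> \bar R}.
Context (f_neqNy : forall x, f x != -oo).
Context (phi_ge0 : forall z, 0 <= phi z).
Context (phi_eq0 : forall (x : X) (p : P), phi (x, p) = 0 <-> p = p0 /\ M x).

Lemma penalty_feasible (lam : R) (x : X) : M x -> penalty f phi lam (x, p0) = f x.
Proof. by move=> Mx; rewrite /penalty (phi_eq0 x p0).2//= mule0 adde0. Qed.

Lemma penalty_le (l1 l2 : R) (z : X * P) :
  (l1 <= l2)%R -> penalty f phi l1 z <= penalty f phi l2 z.
Proof. by move=> l12; rewrite leeD2l// lee_wpmul2r// lee_fin. Qed.

Lemma le_penalty (lam : R) (z : X * P) :
  (0 <= lam)%R -> f z.1 <= penalty f phi lam z.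
Proof. by move=> l0; rewrite leeDl// mule_ge0// lee_fin. Qed.

(** With [0 < l2], finiteness of the larger penalty excludes [+oo] for both [f] and [phi] at [z],
    which leaves an inequality between reals. *)
Lemma penalty_lt (l1 l2 : R) (z : X * P) : (0 < l2)%R -> (l1 < l2)%R ->
  penalty f phi l2 z < +oo -> 0 < phi z ->
  penalty f phi l1 z < penalty f phi l2 z.
Proof.
rewrite /penalty => l20 l12.
have := f_neqNy z.1; have := phi_ge0 z.
case: (f z.1) => [a| |]//; case: (phi z) => [b| |]//.
- by rewrite -!EFinM -!EFinD !lte_fin lee_fin => _ _ _ b0; rewrite ltrD2l ltr_pM2r.
- by rewrite gt0_muley ?lte_fin.
- by rewrite gt0_muley ?lte_fin.
Qed.

Lemma globally_optimal_val (x y : X) :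
  globally_optimal f M A x -> globally_optimal f M A y -> f x = f y.
Proof.
by move=> [Sx xmin] [Sy ymin]; apply/eqP; rewrite eq_le xmin ?ymin.
Qed.

Lemma global_minimizer_le_parameter (l0 lam : R) (x : X) : (l0 <= lam)%R ->
  global_minimizer (penalty f phi l0) (A `*` [set: P]) (x, p0) -> M x ->
  global_minimizer (penalty f phi lam) (A `*` [set: P]) (x, p0).
Proof.
move=> llam [Ax xmin] Mx; split => // z Sz.
rewrite penalty_feasible// -(penalty_feasible l0 Mx).
exact: le_trans (xmin _ Sz) (penalty_le z llam).
Qed.

(** A minimizer for [l2] with positive [phi] would have a penalty below [f x] at the smaller
    parameter [l1], against the lower bound. So [phi] vanishes at every minimizer, which makes it
    feasible. *)
Lemma globally_exact_of_minimum (l1 l2 : R) (x : X) :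
  (0 < l2)%R -> (l1 < l2)%R -> globally_optimal f M A x -> f x \is a fin_num ->
  (forall z, (A `*` [set: P]) z -> f x <= penalty f phi l1 z) ->
  globally_exact f M A p0 phi.
Proof.
move=> l20 l12 xopt fx lb.
have optmin y : globally_optimal f M A y ->
    global_minimizer (penalty f phi l2) (A `*` [set: P]) (y, p0).
  move=> yopt; have [[My Ay] _] := yopt; split => // z Sz.
  rewrite penalty_feasible// (globally_optimal_val yopt xopt).
  exact: le_trans (lb _ Sz) (penalty_le z (ltW l12)).
exists l2; split; [exact: ltW|by exists (x, p0); exact: optmin|].
move=> y p; split=> [[[/= Ay _] ymin]|[-> yopt]]; last exact: optmin.
have [[Mx Ax] xmin] := xopt.
have ylex : penalty f phi l2 (y, p) <= f x.
  by rewrite -(penalty_feasible l2 Mx); exact: ymin.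
have : phi (y, p) = 0.
  apply/eqP; rewrite eq_le phi_ge0 andbT leNgt; apply/negP => phi0.
  have := penalty_lt l20 l12 (le_lt_trans ylex _) phi0.
  rewrite ltey_eq fx => /(_ isT) /lt_le_trans/(_ ylex).
  by rewrite ltNge lb.
move=> /phi_eq0[pp0 My]; split=> //; split=> // u Su.
apply: le_trans (xmin _ Su); apply: le_trans ylex.
exact: (@le_penalty l2 (y, p) (ltW l20)).
Qed.

Lemma globally_exact_non_degenerate (x : X) :
  globally_optimal f M A x -> globally_exact f M A p0 phi ->
  non_degenerate f A phi.
Proof.
move=> xopt [l0 [l00 _ eqv]]; have [[Mx Ax] _] := xopt.
(* The same point [(x, p0)] minimizes for all parameters from [l0] on, so one radius serves them
   all; the [1] makes it positive. *)
exists l0, (1 + `|x| + `|val p0|)%R; split => //.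
move=> lam llam.
have xmin : global_minimizer (penalty f phi lam) (A `*` [set: P]) (x, p0).
  by apply: global_minimizer_le_parameter llam _ Mx => //; exact/eqv.
split; first by exists (x, p0).
exists x, p0; split => //.
  by rewrite -addrA addrCA lerDl addr_ge0.
by rewrite lerDr addr_ge0.
Qed.

Lemma globally_exact_exact_at (x : X) :
  globally_optimal f M A x -> globally_exact f M A p0 phi -> exact_at f A p0 phi x.
Proof.
move=> xopt [l0 [l00 _ eqv]]; exists l0; split => //.
by have [Sx xmin] := (eqv x p0).2 (conj erefl xopt); split => //;
  apply: (@filterE _ (nbhs (x, p0))) => z; exact: xmin.
Qed.

Lemma cluster_globally_optimal (lam : nat -> R) (z : nat -> X * P)
    (c : X * P) (x : X) :
  (forall n, 0 <= lam n)%R -> lam @ \oo --> +oo%R ->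
  globally_optimal f M A x -> f x \is a fin_num ->
  (forall n, penalty f phi (lam n) (z n) <= f x) ->
  cluster (z @ \oo) c -> A c.1 -> lsc_at f c.1 -> lsc_at phi c ->
  c.2 = p0 /\ globally_optimal f M A c.1.
Proof.
move=> lam0 lamoo [[Mx Ax] xmin] fx zx zc Ac flsc plsc.
have near1 (Q : set X) : nbhs c.1 Q -> nbhs c [set w | Q w.1].
  by move=> cQ; exact: (@cvg_fst _ _ (nbhs c.1) (nbhs c.2)).
have fcx : f c.1 <= f x.
  rewrite leNgt; apply/negP; rewrite -{1}(fineK fx) => /flsc/near1 fc.
  have [n [_]] := cluster_frequently _ [set: nat] zc fc (nearW _ (fun=> I)).
  rewrite /= fineK// ltNge => /negP; apply.
  exact: le_trans (le_penalty (z n) (lam0 n)) (zx n).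
suff pc : phi c = 0.
  move: (pc); rewrite [c in phi c]surjective_pairing => /phi_eq0[-> Mc].
  split => //; split => // y Sy; exact: le_trans fcx (xmin _ Sy).
apply/eqP; rewrite eq_le phi_ge0 andbT leNgt; apply/negP => phi0.
(* [phi c] may be [+oo], so a real [a] strictly below it is chosen, and likewise a real [b] below
   [f c.1]. *)
have [a [a0 aphi]] : exists a : R, (0 < a)%R /\ a%:E < phi c.
  move: phi0; case: (phi c) => [b b0| _|]//.
    exists (b / 2)%R; rewrite !lte_fin in b0 *.
    by rewrite divr_gt0// ltr_pdivrMr// ltr_pMr// ltr1n.
  by exists 1%R; rewrite ltry.
have [b bf] : exists b : R, b%:E < f c.1.
  move: (f_neqNy c.1); case: (f c.1) => [b _| _|]//.
    by exists (b - 1)%R; rewrite lte_fin ltrBlDr ltrDl.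
  by exists 0%R; rewrite ltry.
have near2 := @filterI _ (nbhs c) (nbhs_filter c) _ _
  (near1 _ (flsc _ bf)) (plsc _ aphi).
(* From this threshold on, [b + lam n * a] is at least [f x]; a term near [c] then has penalty above
   [f x]. *)
move/cvgryPge: lamoo => /(_ ((fine (f x) - b) / a)%R).
move=> /(cluster_frequently _ _ zc near2)[n [/= lamn [bn an]]].
have := zx n; rewrite leNgt => /negP; apply.
apply: (@lt_le_trans _ _ (f (z n).1 + (lam n)%:E * a%:E)).
  rewrite -(fineK fx) -EFinM.
  apply: (@le_lt_trans _ _ (b%:E + (lam n * a)%:E)).
    by rewrite -EFinD lee_fin -lerBlDl -ler_pdivrMr.
  by rewrite lteD2rE.
by rewrite leeD2l// lee_wpmul2l ?lee_fin// ltW.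
Qed.

End Penalty.

Theorem theorem3p10 (R : realType) (X Y : normedVectType R)
    (M A : set X) (P : set Y) (p0 : P)
    (f : X -> \bar R) (phi : X * P -> \bar R)
    (M_neq0 : M !=set0) (A_neq0 : A !=set0)
    (f_neqNy : forall x, f x != -oo)
    (f_dom : edom f !=set0)
    (f_min : exists2 x, global_minimizer f (M `&` A) x & f x \is a fin_num)
    (phi_ge0 : forall z, 0 <= phi z)
    (phi_eq0 : forall (x : X) (p : P), phi (x, p) = 0 <-> p = p0 /\ M x)
    (P_closed : closed P) (A_closed : closed A)
    (f_lsc : lsc_on A f)
    (phi_lsc : lsc_on (A `*` [set: P]) phi) :
  globally_exact f M A p0 phi <->
  non_degenerate f A phi /\
  (forall x, globally_optimal f M A x -> exact_at f A p0 phi x).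
Proof.
have [x xopt fx] := f_min; have [[Mx Ax] _] := xopt.
split=> [ex|[[l0 [r [l00 r0 nd]]] loc]].
  split; first exact: globally_exact_non_degenerate xopt ex.
  by move=> y yopt; exact: globally_exact_exact_at yopt ex.
pose lam n : R := (l0 + n%:R)%R.
have llam n : (l0 <= lam n)%R by rewrite lerDl.
have lamoo : lam @ \oo --> +oo%R.
  apply/cvgryPge => a; have := nbhs_infty_ger (a - l0)%R.
  by apply: filterS => n; rewrite lerBlDl.
pose Q n (w : X * P) := [/\
  global_minimizer (penalty f phi (lam n)) (A `*` [set: P]) w,
  (`|w.1| <= r)%R & (`|val w.2| <= r)%R].
have /choice[z zQ] : forall n, exists w, Q n w.
  by move=> n; have [_ [y [p yp]]] := nd _ (llam n); exists (y, p).
(* The second factor must be compact in the subtype [P]; this is where closedness of [P] in [Y]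
   enters. *)
pose K : set (X * P) := (A `&` [set y | `|y| <= r]%R) `*`
  (set_val @^-1` (P `&` [set y | `|y| <= r]%R)).
have Kc : compact K.
  apply: compact_setX.
    by rewrite setIC; apply: compact_closedI => //; exact: compact_norm_le.
  apply: compact_set_val_preimage; last exact: subIsetl.
  by rewrite setIC; apply: compact_closedI => //; exact: compact_norm_le.
have zK : \forall n \near \oo, K (z n).
  apply: nearW => n; have [[[/= Az _] _] zr pr] := zQ n.
  by split; split => //; exact: set_valP.
have [[y p] [[[/= Ay _] _] zc]] := Kc (z @ \oo) _ zK.
have zx n : penalty f phi (lam n) (z n) <= f x.
  have [[_ zmin] _ _] := zQ n.
  by rewrite -(penalty_feasible phi_eq0 (lam n) Mx); exact: zmin.
have /= [pp0 yopt] := cluster_globally_optimal f_neqNy phi_ge0 phi_eq0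
  (fun n => le_trans l00 (llam n)) lamoo xopt fx zx zc Ay (f_lsc y Ay)
  (phi_lsc (y, p) (conj Ay I)).
subst p; have [l1 [l10 [_ ymin]]] := loc _ yopt.
(* [n] is chosen with [l1 <= lam n] and with [z n] in the neighbourhood where [(y, p0)] is minimal
   for [l1]. *)
have [n [l1n zn]] := cluster_frequently _ _ zc ymin ((cvgryPge lam).1 lamoo l1).
have [[Sz zmin] _ _] := zQ n.
have My : M y by case: yopt => -[].
(* The lower bound is proved at [lam n]; the increment [1] gives the strictly larger, positive
   parameter at which exactness holds. *)
apply: (globally_exact_of_minimum f_neqNy phi_ge0 phi_eq0 (l1 := lam n)
  (l2 := (lam n + 1)%R) (x := x)) => //.
- by rewrite ltr_wpDl// (le_trans l00).
- by rewrite ltrDl.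
(* The chain is [f y], the penalty of [z n] for [l1], that of [z n] for [lam n], that of [w] for
   [lam n]. *)
move=> w Sw; rewrite (globally_optimal_val xopt yopt).
rewrite -(penalty_feasible phi_eq0 l1 My).
apply: le_trans (zn Sz) _; apply: le_trans (zmin _ Sw).
exact: penalty_le.
Qed.
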